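(* Let $V$ be a finite set and let $f \colon 2^V \to \mathbb{R}$ be a submodular function given by a function value oracle. Given $S \subseteq V$, whether the function $X \mapsto f(X \vartriangle S)$ is submodular can be decided in time polynomial in $|V|$ (counting each oracle call as one step).
   Context: A set function $h$ on $2^V$ is submodular if $h(X)+h(Y) \ge h(X \cup Y) + h(X \cap Y)$ for all $X,Y \subseteq V$ (no normalization assumed). A function value oracle returns $f(X)$ for a queried $X \subseteq V$. $X \vartriangle S$ is the symmetric difference. *)

(* Defs.v *)
From HB Require Import structures.
From mathcomp Require Import all_boot all_order all_algebra.
From mathcomp Require Import reals.

Set Implicit Arguments.
Unset Strict Implicit.
Unset Printing Implicit Defensive.

Import Order.TTheory GRing.Theory Num.Theory.
Local Open Scope ring_scope.

Definition submodular (R : realType) (V : finType) (h : {set V} -> R) : Prop :=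
  forall X Y : {set V}, h X + h Y >= h (X :|: Y) + h (X :&: Y).

Definition symdiff (V : finType) (X S : {set V}) : {set V} :=
  (X :\: S) :|: (S :\: X).

(* Algorithms are programs for a random access machine with two sorts of      *)
(* storage, natural numbers and reals; each sort has directly addressed       *)
(* registers and an indirectly addressed memory.  Every instruction costs one *)
(* step.  The arithmetic is restricted to addition and subtraction in both    *)
(* sorts: after t steps of a fixed program on a ground set of size n a        *)
(* natural number has O(t + log n) bits, so that unit cost and bit cost are   *)
(* polynomially related, and every real is an integer linear combination of   *)
(* 1 and oracle values.  Only the instruction Query accesses the set function.*)
Variant instr : Type :=
| NConst of nat & nat
| NAdd of nat & nat & nat
| NSub of nat & nat & nat
| NLoad of nat & nat
| NStore of nat & nat
| RConst of nat & int
| RAdd of nat & nat & nat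
| RSub of nat & nat & nat
| RLoad of nat & nat
| RStore of nat & nat
| Query of nat & nat
| NJumpLe of nat & nat & nat
| RJumpLe of nat & nat & nat
| Halt of bool.

Definition program : Type := seq instr.

Section Semantics.
Variables (R : realType) (V : finType).

Record state : Type := State {
  pc : nat;
  reg : nat -> nat;
  mem : nat -> nat;
  rreg : nat -> R;
  rmem : nat -> R }.

Variant config : Type :=
| Running of state
| Halted of bool.

(* A subset of V is stored as its characteristic vector in #|V| consecutive   *)
(* cells, the elements of V being numbered 0, ..., #|V| - 1 by enum_rank.     *)
Definition stored_set (m : nat -> nat) (a : nat) : {set V} :=
  [set v | m (a + enum_rank v)%N != 0%N].

(* Input: register 0 holds #|V|, cells 0, ..., #|V| - 1 of the memory hold    *)
(* the characteristic vector of S, and everything else is 0.                  *)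
Definition init (S : {set V}) : state :=
  State 0
    (fun i => if i == 0%N then #|V| else 0%N)
    (fun i => [exists v in S, (enum_rank v : nat) == i] : nat)
    (fun _ => 0) (fun _ => 0).

Definition set_reg (s : state) (d x : nat) : state :=
  State (pc s).+1 [eta reg s with d |-> x] (mem s) (rreg s) (rmem s).
Definition set_mem (s : state) (i x : nat) : state :=
  State (pc s).+1 (reg s) [eta mem s with i |-> x] (rreg s) (rmem s).
Definition set_rreg (s : state) (d : nat) (x : R) : state :=
  State (pc s).+1 (reg s) (mem s) [eta rreg s with d |-> x] (rmem s).
Definition set_rmem (s : state) (i : nat) (x : R) : state :=
  State (pc s).+1 (reg s) (mem s) (rreg s) [eta rmem s with i |-> x].
Definition jump_if (s : state) (b : bool) (l : nat) : state :=
  State (if b then l else (pc s).+1) (reg s) (mem s) (rreg s) (rmem s).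

Definition exec (f : {set V} -> R) (i : instr) (s : state) : config :=
  match i with
  | NConst d c => Running (set_reg s d c)
  | NAdd d a b => Running (set_reg s d (reg s a + reg s b)%N)
  | NSub d a b => Running (set_reg s d (reg s a - reg s b)%N)
  | NLoad d a => Running (set_reg s d (mem s (reg s a)))
  | NStore a b => Running (set_mem s (reg s a) (reg s b))
  | RConst d c => Running (set_rreg s d c%:~R)
  | RAdd d a b => Running (set_rreg s d (rreg s a + rreg s b))
  | RSub d a b => Running (set_rreg s d (rreg s a - rreg s b))
  | RLoad d a => Running (set_rreg s d (rmem s (reg s a)))
  | RStore a b => Running (set_rmem s (reg s a) (rreg s b))
  | Query d a => Running (set_rreg s d (f (stored_set (mem s) (reg s a))))
  | NJumpLe a b l => Running (jump_if s (reg s a <= reg s b)%N l)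
  | RJumpLe a b l => Running (jump_if s (rreg s a <= rreg s b) l)
  | Halt b => Halted b
  end.

(* Leaving the program text counts as rejecting. *)
Definition step (P : program) (f : {set V} -> R) (c : config) : config :=
  match c with
  | Running s => exec f (nth (Halt false) P (pc s)) s
  | Halted b => Halted b
  end.

Definition answers_within (P : program) (f : {set V} -> R) (S : {set V})
    (t : nat) (b : bool) : Prop :=
  iter t (step P f) (Running (init S)) = Halted b.

End Semantics.

(* Main.v *)
Require Import Defs.
From HB Require Import structures.
From mathcomp Require Import all_boot all_order all_algebra.
From mathcomp Require Import reals.
From mathcomp Require Import zify lra.

Set Implicit Arguments.
Unset Strict Implicit.
Unset Printing Implicit Defensive.

Import Order.TTheory GRing.Theory Num.Theory.
Local Open Scope ring_scope.

(* Submodularity of X |-> f (X /\ S) (symmetric difference), applied to S and *)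
(* ~: S, gives f(S) + f(~: S) <= f(0) + f(V).  Conversely this single         *)
(* inequality forces f(X) = f(X :&: S) + f(X :\: S) - f(0) for every X, so f  *)
(* splits as a submodular function on S plus one on ~: S, and complementing   *)
(* the argument within S preserves submodularity of the first summand.  Four  *)
(* oracle calls therefore suffice.                                            *)

(** Since [f] already satisfies the reverse inequality at [S] and [~: S], the test asks for equality
    there: [f] is then modular across this cut ([submodular_split]), which characterises
    submodularity of the twist ([submodular_symdiffE]). A linear-time program evaluates the test
    ([tightness_program_correct]). *)

Section TwistedSubmodularity.
Variables (R : realType) (V : finType) (f : {set V} -> R) (S : {set V}).
Hypothesis f_submod : submodular f.

(** The pair [X :&: S], [X :\: S] bounds [f X] from above. Adding the inequalities for [X], [S] and
    for [X :|: S], [~: S] cancels [f (X :|: S)], and [tight] turns the sum into the matching lower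
    bound. *)
Lemma submodular_split (X : {set V}) :
  f S + f (~: S) <= f set0 + f setT ->
  f X = f (X :&: S) + f (X :\: S) - f set0.
Proof.
move=> tight.
have upper := f_submod (X :&: S) (X :\: S).
have lower1 := f_submod X S.
have lower2 := f_submod (X :|: S) (~: S).
have e1 : (X :&: S) :|: (X :\: S) = X by rewrite setID.
have e2 : (X :&: S) :&: (X :\: S) = set0.
  by apply/setP => v; rewrite !inE; case: (v \in S); rewrite ?andbF.
have e3 : (X :|: S) :|: ~: S = setT by rewrite -setUA setUCr setUT.
have e4 : (X :|: S) :&: ~: S = X :\: S.
  by rewrite setIUl setICr setU0 setDE.
rewrite e1 e2 in upper; rewrite e3 e4 in lower2; lra.
Qed.

Lemma submodular_symdiffE :
  submodular (fun X => f (symdiff X S)) <->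
  f S + f (~: S) <= f set0 + f setT.
Proof.
split=> [g_submod | tight X Y].
  have := g_submod S (~: S); rewrite setUCr setICr.
  have -> : symdiff set0 S = S by rewrite /symdiff set0D set0U setD0.
  have -> : symdiff setT S = ~: S by rewrite /symdiff setTD setDT setU0.
  have -> : symdiff S S = set0 by rewrite /symdiff setDv setU0.
  have -> : symdiff (~: S) S = setT.
    by apply/setP => v; rewrite !inE; case: (v \in S).
  lra.
have splitE Z : f (symdiff Z S) = f (S :\: Z) + f (Z :\: S) - f set0.
  rewrite (submodular_split _ tight) /symdiff.
  congr (f _ + f _ - _); apply/setP => v; rewrite !inE;
  by case: (v \in S); case: (v \in Z).
(* Complementing within [S] swaps unions and intersections, and the submodular inequality is
   symmetric in the two. *)
rewrite !splitE setDUr setDIr setDUl.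
have -> : (X :&: Y) :\: S = (X :\: S) :&: (Y :\: S) by rewrite -setDIl.
have := f_submod (S :\: X) (S :\: Y); have := f_submod (X :\: S) (Y :\: S).
lra.
Qed.

End TwistedSubmodularity.

(* The loop 3-10 fills cells 0, ..., n - 1 with ones and writes the           *)
(* complement of S to cells n, ..., 2n - 1.  Before it, cells n, ..., 2n - 1  *)
(* hold the empty set; register 5 is never written and stays 0.               *)
Definition tightness_program : program := [::
  (*  0 *) Query 0 0;
  (*  1 *) Query 1 1;
  (*  2 *) NConst 2 1;
  (*  3 *) NJumpLe 0 1 11;
  (*  4 *) NLoad 3 1;
  (*  5 *) NSub 3 2 3;
  (*  6 *) NAdd 4 0 1;
  (*  7 *) NStore 4 3;
  (*  8 *) NStore 1 2;
  (*  9 *) NAdd 1 1 2;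
  (* 10 *) NJumpLe 5 5 3;
  (* 11 *) Query 2 5;
  (* 12 *) Query 3 0;
  (* 13 *) RAdd 0 0 2;
  (* 14 *) RAdd 1 1 3;
  (* 15 *) RJumpLe 1 0 17;
  (* 16 *) Halt false;
  (* 17 *) Halt true].

Section Correctness.
Variables (R : realType) (V : finType) (f : {set V} -> R) (S : {set V}).

Definition indicator (j : nat) : bool :=
  [exists v in S, (enum_rank v : nat) == j].

Lemma indicator_enum_rank v : indicator (enum_rank v) = (v \in S).
Proof.
apply/existsP/idP => [[w /andP[wS /eqP/val_inj/enum_rank_inj <-]] // | vS].
by exists v; rewrite vS eqxx.
Qed.

Lemma indicator_ge j : (#|V| <= j)%N -> indicator j = false.
Proof.
move=> le_n_j; apply/existsP => -[v /andP[_ /eqP e]].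
by have := ltn_ord (enum_rank v); rewrite e ltnNge le_n_j.
Qed.

(** Loop invariant with [i] elements processed and [k] left: each pass costs 8 steps, and the exit
    test, final queries, comparison and halt cost 7. *)
Lemma tightness_program_loop (k i : nat) (r m : nat -> nat) (rr rm : nat -> R) :
  (i + k)%N = #|V| ->
  r 0%N = #|V| -> r 1%N = i -> r 2%N = 1%N -> r 5%N = 0%N ->
  rr 0%N = f set0 -> rr 1%N = f S ->
  (forall j, (j < #|V|)%N -> m j = if (j < i)%N then 1%N else indicator j) ->
  (forall j, (j < i)%N -> m (#|V| + j)%N = ~~ indicator j) ->
  iter (8 * k + 7) (step tightness_program f) (Running (State 3 r m rr rm))
  = Halted _ (f S + f (~: S) <= f set0 + f setT).
Proof.
elim: k i r m rr rm => [|k IHk] i r m rr rm ik r0 r1 r2 r5 rr0 rr1 mlow mhigh.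
  have in_ : i = #|V| by rewrite -ik addn0.
  have storedT : stored_set V m 0 = setT.
    apply/setP => v; rewrite !inE add0n mlow ?ltn_ord //.
    by rewrite in_ ltn_ord.
  have storedC : stored_set V m #|V| = ~: S.
    apply/setP => v; rewrite !inE mhigh ?in_ ?ltn_ord //.
    by rewrite indicator_enum_rank; case: (v \in S).
  rewrite muln0 add0n !iterSr /= /jump_if /= r0 r1 in_ leqnn /=.
  rewrite r0 r5 storedT storedC rr0 rr1.
  by case: ifP.
have lt_i_n : (i < #|V|)%N by lia.
(* The conditional jump is split off as the first step; the other 7 complete the pass. *)
have -> : (8 * k.+1 + 7 = (8 * k + 7) + 7 + 1)%N by lia.
move: (8 * k + 7)%N IHk => t IHk.
rewrite !iterD /= /jump_if /= r0 r1 leqNgt lt_i_n /= r0 r1 r2 r5 leqnn /=.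
apply: (IHk i.+1) => //=; rewrite ?mlow // ?ltnn ?addn1 ?addSnnS //.
- move=> j lt_j_n; have [-> | ne_ji] := eqVneq j i; first by rewrite ltnSn.
  rewrite (@ltn_eqF j (#|V| + i)) ?ltn_addr //.
  by rewrite mlow // ltnS [in RHS]leq_eqVlt (negbTE ne_ji).
- move=> j le_j_i; rewrite gtn_eqF ?ltn_addr //.
  rewrite eqn_add2l; have [-> | ne_ji] := eqVneq j i.
    by case: indicator.
  by rewrite mhigh // ltn_neqAle ne_ji.
Qed.

Lemma tightness_program_correct :
  answers_within tightness_program f S (8 * #|V| + 10)
    (f S + f (~: S) <= f set0 + f setT).
Proof.
rewrite /answers_within.
(* Three instructions precede the loop. *)
have -> : (8 * #|V| + 10 = (8 * #|V| + 7) + 3)%N by lia.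
rewrite iterD; apply: (@tightness_program_loop _ 0%N) => //=.
- congr f; apply/setP => v; rewrite !inE -/(indicator _).
  by rewrite indicator_ge ?leq_addr.
- congr f; apply/setP => v; rewrite !inE -/(indicator _) add0n.
  by rewrite indicator_enum_rank; case: (v \in S).
Qed.

End Correctness.

Theorem theorem3p14 (R : realType) :
  exists (P : program) (p : {poly nat}),
    forall (V : finType) (f : {set V} -> R) (S : {set V}),
      submodular f ->
      exists b : bool,
        answers_within P f S p.[#|V|] b /\
        (b = true <-> submodular (fun X : {set V} => f (symdiff X S))).
Proof.
exists tightness_program, (8%N%:P * 'X + 10%N%:P) => V f S f_submod.
exists (f S + f (~: S) <= f set0 + f setT); split.
  rewrite hornerD hornerM hornerX !hornerC.
  exact: tightness_program_correct.
exact: iff_sym (submodular_symdiffE S f_submod).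
Qed.
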